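(* Let $g\ge 1$, $x=(x_1,\dots,x_g)$, $x^*=(x_1^*,\dots,x_g^* )$. A left monomial ideal $I\subseteq\mathbb{R}\langle x,x^*\rangle$ is real if and only if it is generated (as a left ideal) by left unshrinkable words. Hence a finitely generated left monomial ideal $I$ is real if and only if it has the left Nullstellensatz property, i.e. $\sqrt{I}=I$.
   Context: $\langle x,x^*\rangle$ is the free monoid of words in the $2g$ noncommuting letters $x_1,\dots,x_g,x_1^*,\dots,x_g^*$ (the empty word is the identity $1$), and $\mathbb{R}\langle x,x^*\rangle$ is the free unital associative $\mathbb{R}$-algebra on these letters, with the $\mathbb{R}$-linear involution $*$ that exchanges $x_i$ and $x_i^*$ and reverses products. For a left ideal $I$, $I^*=\{a^*: a\in I\}$. A left ideal $I$ is real if whenever $a_1,\dots,a_r\in\mathbb{R}\langle x,x^*\rangle$ satisfy $\sum_{i=1}^r a_i^*a_i\in I+I^*$, then $a_1,\dots,a_r\in I$. A left monomial ideal is a left ideal generated by a (possibly infinite) set of words. A word $w$ is left unshrinkable if it cannot be written as $w=uu^*v$ with words $u,v$ and $u\ne 1$. For $X\in(\mathbb{R}^{n\times n})^g$, $p(X)$ denotes the evaluation of $p$ with $x_i\mapsto X_i$, $x_i^*\mapsto X_i^{T}$. For a left ideal $I$, $V(I)=\bigcup_{n\in\mathbb{N}}\{(X,v)\in(\mathbb{R}^{n\times n})^g\times\mathbb{R}^n : p(X)v=0 \text{ for all } p\in I\}$, and $\sqrt{I}=\{p\in\mathbb{R}\langle x,x^*\rangle : p(X)v=0\text{ for all }(X,v)\in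 V(I)\}$. $I$ has the left Nullstellensatz property if $\sqrt I=I$. *)

(* Defs.v *)
From mathcomp Require Import all_boot all_order all_algebra.
From mathcomp Require Import classical_sets cardinality reals.
From mathcomp Require Import finmap monalg.

Set Implicit Arguments.
Unset Strict Implicit.
Unset Printing Implicit Defensive.

Import Order.TTheory GRing.Theory Num.Theory.
Local Open Scope classical_set_scope.
Local Open Scope ring_scope.

(* The letter (i, false) is x_i and (i, true) is x_i^*. *)
Notation letter g := ('I_g * bool)%type.
Notation word g := {fmonom (letter g)}.
Notation falg R g := {malg R[word g]}.

Definition letter_star g (l : letter g) : letter g := (l.1, ~~ l.2).

Definition word_star g (w : word g) : word g :=
  FMonom (rev [seq letter_star l | l <- w]).

Definition left_unshrinkable g (w : word g) : Prop :=
  ~ exists u v : word g, u <> mone /\ w = mmul (mmul u (word_star u)) v.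

Section Ideals.
Context (R : realType) (g : nat).
Local Notation A := (falg R g).

Definition star (p : A) : A := \sum_(w <- msupp p) << p@_w *g word_star w >>.

Definition left_ideal (I : set A) : Prop :=
  [/\ I 0, forall a b, I a -> I b -> I (a + b)
    & forall p a, I a -> I (p * a)].

Definition left_ideal_gen (S : set A) : set A := smallest left_ideal S.

Definition monomials (W : set (word g)) : set A := [set << w >> | w in W].

Definition left_monomial_ideal (I : set A) : Prop :=
  exists W : set (word g), I = left_ideal_gen (monomials W).

Definition fin_gen_left_ideal (I : set A) : Prop :=
  exists2 S : set A, finite_set S & I = left_ideal_gen S.

Definition real_left_ideal (I : set A) : Prop :=
  forall (r : nat) (a : 'I_r -> A),
    [set b + c | b in I & c in star @` I] (\sum_(i < r) star (a i) * a i) ->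
    forall i, I (a i).

(* Matrix sizes are written n.+1 so that 'M[R]_n.+1 is a unital ring with
   1 <> 0; a 0 x 0 point would impose no condition anywhere below. *)
Definition letter_eval n (X : 'I_g -> 'M[R]_n.+1) (l : letter g) : 'M[R]_n.+1 :=
  if l.2 then (X l.1)^T else X l.1.

Definition word_eval n (X : 'I_g -> 'M[R]_n.+1) (w : word g) : 'M[R]_n.+1 :=
  \prod_(l <- (w : seq (letter g))) letter_eval X l.

Definition eval n (X : 'I_g -> 'M[R]_n.+1) (p : A) : 'M[R]_n.+1 :=
  mmap (@scalar_mx R n.+1) (word_eval X) p.

(* V(I) is the disjoint union over n of the sets zero_locus I n. *)
Definition zero_locus (I : set A) (n : nat) :
    set (('I_g -> 'M[R]_n.+1) * 'cV[R]_n.+1) :=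
  [set Xv | forall p, I p -> eval Xv.1 p *m Xv.2 = 0].

Definition left_radical (I : set A) : set A :=
  [set p | forall n Xv, @zero_locus I n Xv -> eval Xv.1 p *m Xv.2 = 0].

Definition left_nullstellensatz_property (I : set A) : Prop :=
  left_radical I = I.

End Ideals.

(* Main.v *)
Require Import Defs.
From HB Require Import structures.
From mathcomp Require Import all_boot all_order all_algebra.
From mathcomp Require Import boolp classical_sets cardinality reals.
From mathcomp Require Import finmap monalg.
From mathcomp Require Import zify ring lra.

(* Let [M] be the set of words of the monomial ideal [I].  If [I] is real and
   [u u^* v] lies in [M], then [(u^* v)^* (u^* v)] does too, so [u^* v] lies in
   [M]: minimal words of [M] are unshrinkable.  Conversely, if the generators
   are unshrinkable then [z^* z] in [M] forces [z] in [M].  So the functional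
   [L] that sends [z^* z], for [z] a word of length [d] outside [M], to
   [t ^ (2 d^2)] and every other word to 0 vanishes on [I + I^*], and for large
   [t] the Gram matrix of the words outside [M] of length at most [N] is
   diagonally dominant.  The truncated GNS construction then gives one point
   [(X, v)] such that, for [p] of degree at most [N], [p(X) v = 0] exactly when
   [p] is in [I].  Both the reality of [I] and, when [I] is finitely generated,
   the Nullstellensatz property are read off from such a point. *)

Set Implicit Arguments.
Unset Strict Implicit.
Unset Printing Implicit Defensive.

Import Order.TTheory GRing.Theory Num.Theory.
Local Open Scope classical_set_scope.
Local Open Scope ring_scope.

(** * Positive definite matrices and operators with a prescribed adjoint *)

Section PositiveDefinite.
Context (F : rcfType).

Definition posdef n (G : 'M[F]_n) : Prop :=
  forall x : 'cV_n, x != 0 -> 0 < (x^T *m G *m x) 0 0.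

Lemma posdef_unit n (G : 'M[F]_n) : posdef G -> G \in unitmx.
Proof.
move=> Gpos; rewrite -row_free_unit; apply: inj_row_free => v vG0.
apply/eqP/negP => /negP v0.
have := Gpos v^T; rewrite trmxK vG0 mul0mx mxE ltxx.
by rewrite -(inj_eq trmx_inj) trmxK trmx0 => /(_ v0).
Qed.

(** Induction on the size: the Schur complement of the corner entry is again symmetric and positive
    definite, and its factor is bordered by the square root of that entry. *)
Lemma cholesky n (G : 'M[F]_n) :
  G^T = G -> posdef G -> exists S : 'M_n, G = S^T *m S.
Proof.
elim: n G => [|n IH] G Gsym Gpos; first by exists 0; rewrite flatmx0 [RHS]flatmx0.
move: G Gsym Gpos; rewrite -[n.+1]/(1 + n)%N => G Gsym Gpos.
pose a := G 0 0; pose b := dlsubmx G; pose D := drsubmx G.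
have GE : G = block_mx a%:M b^T b D.
  rewrite -[LHS]submxK; congr block_mx.
    apply/matrixP => i j; rewrite !ord1 !mxE eqxx mulr1n.
    by congr (G _ _); apply/val_inj.
  by rewrite -[LHS]trmxK trmx_ursub Gsym.
have Dsym : D^T = D by rewrite /D trmx_drsub Gsym.
have a_gt0 : 0 < a.
  have := Gpos (col_mx 1 0); rewrite GE tr_col_mx mul_row_block mul_row_col.
  rewrite !trmx1 !trmx0 !mul0mx !mulmx0 !addr0 mul1mx mulmx1 mxE eqxx; apply.
  by rewrite col_mx_eq0 oner_eq0.
have [|y y0|S DE] := IH (D - a^-1 *: (b *m b^T)).
- by rewrite linearB linearZ /= trmx_mul trmxK Dsym.
(* This vector minimises the form of [G] among those with lower block [y]; the minimum is the form
   of the Schur complement at [y]. *)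
- have := Gpos (col_mx (- a^-1 *: (b^T *m y)) y).
  rewrite GE tr_col_mx mul_row_block mul_row_col col_mx_eq0 (negPf y0) andbF.
  move=> /(_ isT); congr (0 < fun_of_matrix _ 0 0).
  have -> : (- a^-1 *: (b^T *m y))^T = - a^-1 *: (b^T *m y)^T by rewrite linearZ.
  rewrite trmx_mul trmxK mul_mx_scalar scalerA mulrN divff ?gt_eqF //.
  rewrite scaleN1r addNr mul0mx add0r.
  rewrite mulmxBr mulmxBl mulmxDl addrC.
  by rewrite -!scalemxAl -!scalemxAr -!scalemxAl !mulmxA scaleNr.
- pose c := Num.sqrt a.
  have c0 : c != 0 by rewrite sqrtr_eq0 -ltNge.
  have cc : c * c = a by rewrite -expr2 sqr_sqrtr // ltW.
  exists (block_mx c%:M (c^-1 *: b^T) 0 S).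
  rewrite GE tr_block_mx mulmx_block !trmx0 !mul0mx !mulmx0 !addr0 tr_scalar_mx.
  rewrite -scalar_mxM cc mul_scalar_mx scalerA divff // scale1r mul_mx_scalar.
  rewrite linearZ /= trmxK scalerA divff // scale1r -DE -scalemxAl -scalemxAr.
  by rewrite scalerA -invfM cc addrC subrK.
Qed.

(** In the rescaled coordinates [s i * x i] the diagonal contributes the sum of squares, and the
    off-diagonal terms cost at most half of it. *)
Lemma posdef_dominant n (G : 'M[F]_n) (s : 'I_n -> F) :
    (forall i, 0 < s i) -> (forall i, G i i = s i ^+ 2) ->
    (forall i j, i != j -> 2 * n%:R * `|G i j| <= s i * s j) ->
  posdef G.
Proof.
move=> s_gt0 Gii Gij x x0; pose y i := s i * x i 0.
have n_gt0 : 0 < n%:R :> F.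
  by case: n x x0 {G s s_gt0 Gii Gij y} => [x|n]; rewrite ?ltr0Sn // flatmx0 eqxx.
(* The loss comes from [2 |y i| |y j| <= y i ^ 2 + y j ^ 2]. It is charged on the diagonal too, so
   that the [E i j] add up to exactly half the sum of squares. *)
pose E i j := (i == j)%:R * y i ^+ 2 - (y i ^+ 2 + y j ^+ 2) / (4 * n%:R).
have leE i j : E i j <= x i 0 * G i j * x j 0.
  rewrite /E; have [<-|ij] := eqVneq i j.
    have -> : x i 0 * G i i * x i 0 = 1 * y i ^+ 2 by rewrite Gii /y; ring.
    rewrite lerBlDr lerDl.
    by rewrite divr_ge0 ?addr_ge0 ?sqr_ge0 ?mulr_ge0.
  rewrite mul0r sub0r lerNl -mulNr ler_pdivlMr ?mulr_gt0 //.
  apply: le_trans (_ : 2 * (`|y i| * `|y j|) <= _); last first.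
    rewrite -(real_normK (num_real (y i))) -(real_normK (num_real (y j))).
    by have := sqr_ge0 (`|y i| - `|y j|); lra.
  have := ler_wpM2l (mulr_ge0 (normr_ge0 (x i 0)) (normr_ge0 (x j 0))) (Gij i j ij).
  rewrite /y !normrM !(gtr0_norm (s_gt0 _)).
  have := ler_norm (- x i 0 * G i j * x j 0); rewrite !normrM normrN.
  move=> h1 h2; have := ler_wpM2r (ltW n_gt0) h1; rewrite !mulNr in h1 *; nra.
have -> : (x^T *m G *m x) 0 0 = \sum_j \sum_i x i 0 * G i j * x j 0.
  rewrite mxE; apply: eq_bigr => j _; rewrite mxE mulr_suml.
  by apply: eq_bigr => i _; rewrite mxE.
apply: lt_le_trans (ler_sum _ (fun j _ => ler_sum _ (fun i _ => leE i j))).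
pose Y := \sum_i y i ^+ 2.
have Y_gt0 : 0 < Y.
  have [i xi0] : exists i, x i 0 != 0.
    apply/existsP; apply: contraNT x0; rewrite negb_exists => /forallP x0.
    by apply/eqP/colP => i; rewrite mxE; apply/eqP/negPn.
  rewrite /Y (bigD1 i) //= ltr_pwDl ?sumr_ge0 // => [|j _]; last exact: sqr_ge0.
  by rewrite exprn_even_gt0 //= mulf_neq0 // gt_eqF.
suff -> : \sum_j \sum_i E i j = Y / 2 by rewrite divr_gt0.
transitivity (\sum_j (y j ^+ 2 - (Y + n%:R * y j ^+ 2) / (4 * n%:R))).
  apply: eq_bigr => j _; rewrite big_split /= sumrN -mulr_suml big_split /=.
  rewrite (bigD1 j) //= eqxx mul1r big1 ?addr0 => [|i /negPf->]; last by rewrite mul0r.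
  by rewrite sumr_const card_ord -[y j ^+ 2 *+ n]mulr_natl.
rewrite big_split /= sumrN -mulr_suml big_split /= -mulr_sumr sumr_const card_ord.
rewrite -/Y -[Y *+ n]mulr_natl; field; rewrite ?gt_eqF //.
Qed.

(* With [Q] the Moore-Penrose inverse of [V], [V *m Q] is the orthogonal
   projection onto the column space of [V]. *)
Lemma adjoint_extension n k (V A B : 'M[F]_(n, k)) :
    V^T *m V \in unitmx -> A^T *m V = V^T *m B ->
  exists X : 'M_n, X *m V = A /\ X^T *m V = B.
Proof.
move=> Vunit AVB; pose Q := invmx (V^T *m V) *m V^T.
have QV : Q *m V = 1%:M by rewrite -mulmxA mulVmx.
have VQT : (V *m Q)^T = V *m Q.
  by rewrite /Q !trmx_mul trmxK trmx_inv trmx_mul trmxK mulmxA.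
(* The second summand kills the columns of [V], so [X *m V] is unaffected; its transpose supplies
   the part of [B] orthogonal to those columns. *)
exists (A *m Q + Q^T *m B^T *m (1%:M - V *m Q)); split.
  by rewrite mulmxDl -mulmxA QV mulmx1 -[_ *m _ *m V]mulmxA mulmxBl mul1mx
             -(mulmxA V) QV mulmx1 subrr mulmx0 addr0.
rewrite linearD /= (trmx_mul A) (trmx_mul (Q^T *m B^T)) (trmx_mul Q^T) !trmxK.
rewrite linearB /= trmx1 VQT mulmxDl -(mulmxA (1%:M - _)) -(mulmxA B) QV mulmx1.
by rewrite -(mulmxA Q^T) AVB mulmxA -trmx_mul VQT mulmxBl mul1mx addrC subrK.
Qed.
End PositiveDefinite.

(** * Words and their involution *)

Section Words.
Context (g : nat).
Implicit Types u v w : word g.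

Lemma word_mulE u v : mmul u v = FMonom (u ++ v).
Proof. exact: fmmulE. Qed.

Lemma word_oneE : mone = FMonom [::] :> word g.
Proof. exact: fmoneE. Qed.

Lemma size_word_mul u v : size (mmul u v) = (size u + size v)%N.
Proof. exact: fdegM. Qed.

Lemma size_word_star w : size (word_star w) = size w.
Proof. by rewrite size_rev size_map. Qed.

Lemma word_starK : involutive (@word_star g).
Proof.
move=> w; apply: val_inj; rewrite /= map_rev revK -map_comp map_id_in //.
by case=> i b _; rewrite /= /letter_star /= negbK.
Qed.

Lemma word_starM u v :
  word_star (mmul u v) = mmul (word_star v) (word_star u).
Proof. by rewrite !word_mulE; congr FMonom; rewrite /= map_cat rev_cat. Qed.

(** Equal lengths force both factorizations to cut the word at its midpoint. *)
Lemma word_sqr_inj u v z :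
    size u = size v -> mmul (word_star u) v = mmul (word_star z) z -> u = v.
Proof.
rewrite !word_mulE => uv [/eqP]; move=> E.
have zu : size z = size u.
  move/eqP/(congr1 size): E; rewrite !size_cat /= !size_word_star -uv !addnn.
  by move/double_inj.
move: E; rewrite eqseq_cat; last by rewrite !size_word_star zu.
case/andP => /eqP uz /eqP vz; have -> : v = z by apply: val_inj.
by apply: (can_inj word_starK); apply: val_inj.
Qed.
End Words.

(** * The truncated GNS construction *)

Section GelfandNaimarkSegal.
Context (R : realType) (g : nat) (M : set (word g)).
Implicit Types (u v w : word g) (t : R) (p : falg R g).

Definition nonvanishing_sqr w : bool :=
  `[< exists z, ~ M z /\ w = mmul (word_star z) z >].

(* Any weight whose logarithm is strictly convex in the degree and steep enough
   makes the Gram matrix diagonally dominant; [t ^+ (2 * d ^ 2)] is one. *)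
Definition gns_state t w : R :=
  if nonvanishing_sqr w then t ^+ (2 * (size w)./2 ^ 2) else 0.

Definition gns_gram t u v : R := gns_state t (mmul (word_star u) v).

Definition gns_weight t u : R := t ^+ (size u ^ 2).

Lemma gns_state_star t w : gns_state t (word_star w) = gns_state t w.
Proof.
rewrite /gns_state size_word_star; congr (if _ then _ else _).
apply: asbool_equiv_eq; split=> -[z [Mz E]]; exists z; split=> //.
  by rewrite -[LHS]word_starK E word_starM word_starK.
by rewrite E word_starM word_starK.
Qed.

Lemma gns_gramC t u v : gns_gram t u v = gns_gram t v u.
Proof. by rewrite /gns_gram -gns_state_star word_starM word_starK. Qed.

(** Left multiplications by a letter and by its star are adjoint for the Gram form; this is the
    compatibility that [adjoint_extension] asks for. *)
Lemma gns_gram_mul t l u v :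
  gns_gram t (mmul l u) v = gns_gram t u (mmul (word_star l) v).
Proof. by rewrite /gns_gram word_starM mulmA. Qed.

Lemma gns_gram_sqr t u : ~ M u -> gns_gram t u u = gns_weight t u ^+ 2.
Proof.
move=> Mu; rewrite /gns_gram /gns_state ifT; last by apply/asboolP; exists u.
rewrite word_mulE /= size_cat size_word_star addnn doubleK.
by rewrite /gns_weight -exprM mulnC.
Qed.

(** If the entry is nonzero, [word_sqr_inj] forces the lengths to be [d + k] and [d - k] with [k]
    nonzero. Their squares sum to [2 d^2 + 2 k^2], which exceeds [2 d^2], and the spare factor [t]
    absorbs [c]. *)
Lemma gns_gram_dominated t (c : R) u v : 1 <= t -> 0 <= c <= t -> u != v ->
  c * `|gns_gram t u v| <= gns_weight t u * gns_weight t v.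
Proof.
move=> t1 /andP[c0 ct] uv; have t0 : 0 <= t by rewrite (le_trans ler01).
rewrite /gns_gram /gns_state /nonvanishing_sqr.
case: asboolP => [[z [Mz E]]|_]; last first.
  by rewrite normr0 mulr0 mulr_ge0 // exprn_ge0.
have szE : (size u + size v = (size z).*2)%N.
  have /(congr1 (fun w : word g => size w)) := E.
  by rewrite !word_mulE /= !size_cat !size_word_star addnn.
have sz : size u != size v.
  by apply: contra_neq uv => suv; exact: word_sqr_inj suv E.
rewrite word_mulE /= size_cat size_word_star szE doubleK ger0_norm ?exprn_ge0 //.
apply: le_trans (ler_wpM2r (exprn_ge0 _ t0) ct) _.
rewrite -exprS /gns_weight -exprD ler_weXn2l //.
move/eqP: sz => sz; nia.
Qed.

Lemma gns_gram_posdef t (s : seq (word g)) :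
    1 <= t -> 2 * (size s)%:R <= t -> uniq s -> {in s, forall u, ~ M u} ->
  posdef (\matrix_(i < size s, j < size s) gns_gram t (nth mone s i) (nth mone s j)).
Proof.
move=> t1 st us Ms.
apply: (@posdef_dominant _ _ _ (fun i => gns_weight t (nth mone s i))) => [i|i|i j ij].
- by rewrite exprn_gt0 // (lt_le_trans ltr01).
- by rewrite mxE gns_gram_sqr //; apply/Ms/mem_nth.
- rewrite mxE gns_gram_dominated ?st ?mulr_ge0 //.
  by rewrite nth_uniq.
Qed.

Hypothesis M_mull : forall u w, M w -> M (mmul u w).
Hypothesis M_real : forall u, M (mmul (word_star u) u) -> M u.

Lemma gns_state_eq0 t w : M w -> gns_state t w = 0.
Proof.
move=> Mw; rewrite /gns_state /nonvanishing_sqr; case: asboolP => // -[z [Mz E]].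
by case: Mz; apply: M_real; rewrite -E.
Qed.

Lemma gns_gram_eq0r t u v : M v -> gns_gram t u v = 0.
Proof. by move=> Mv; apply/gns_state_eq0/M_mull. Qed.

Lemma gns_gram_eq0l t u v : M u -> gns_gram t u v = 0.
Proof. by rewrite gns_gramC; exact: gns_gram_eq0r. Qed.

(** These words form a basis of the polynomials of degree at most [N] modulo those supported on
    [M]. *)
Definition standard_words N : seq (word g) :=
  [seq w <- [seq FMonom (b : seq (letter g)) | b : {bseq N of letter g}]
  | ~~ `[< M w >]].

Lemma mem_standard_words N w :
  (w \in standard_words N) = (size w <= N)%N && ~~ `[< M w >].
Proof.
rewrite mem_filter andbC; congr (_ && _); apply/fintype.imageP/idP => [[b _ ->]|wN].
  exact: size_bseq.
by exists (Bseq wN); rewrite // fmK.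
Qed.

Lemma standard_words_uniq N : uniq (standard_words N).
Proof.
apply/filter_uniq; rewrite map_inj_uniq ?enum_uniq // => a b [].
exact: val_inj.
Qed.

(** The Gram form makes the truncated quotient a Euclidean space. A Cholesky factor [S] maps it
    isometrically onto the standard one, and injectivity of [S] gives the linear independence in the
    last clause. *)
Lemma gns_vectors t N :
    ~ M mone -> 1 <= t -> 2 * (size (standard_words N))%:R <= t ->
  exists n (f : word g -> 'cV[R]_n.+1),
  [/\ forall w, M w -> f w = 0,
      forall u v, (size u <= N)%N -> (size v <= N)%N ->
        ((f u)^T *m f v) 0 0 = gns_gram t u v
    & forall p, (forall w, w \in msupp p -> (size w <= N)%N) ->
        \sum_(w <- msupp p) p@_w *: f w = 0 -> forall w, w \in msupp p -> M w].
Proof.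
move=> M1 t1 tN; set s := standard_words N in tN.
have sM u : u \in s -> ~ M u by rewrite mem_standard_words => /andP[_ /asboolP].
have Gpos := gns_gram_posdef t1 tN (standard_words_uniq N) sM.
move: Gpos; rewrite -/s.
(* The empty word makes [s] nonempty, so the dimension has the required form [n.+1]. *)
have : mone \in s.
  by rewrite mem_standard_words; apply/andP; split; [rewrite word_oneE|apply/asboolP].
case sE: (size s) => [|n]; first by move/size0nil: sE => ->.
move=> _; set G := \matrix_(i, j) _ => Gpos.
have [|S GS] := cholesky _ Gpos.
  by apply/matrixP => i j; rewrite !mxE gns_gramC.
have S_inj (x : 'cV_n.+1) : S *m x = 0 -> x = 0.
  move=> Sx0; apply/eqP/negP => /negP /Gpos.
  by rewrite GS -!mulmxA Sx0 !mulmx0 mxE ltxx.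
(* The indicator is a basis vector for [w] in [s] and 0 for every other word, in particular on
   [M]. *)
pose e w : 'cV[R]_n.+1 := \col_i (nth mone s i == w)%:R.
have e0 w : M w -> e w = 0.
  move=> Mw; apply/colP => i; rewrite !mxE; case: eqP => // siw.
  by case: (sM (nth mone s i)); rewrite ?mem_nth ?sE // siw.
have eE (i : 'I_n.+1) : e (nth mone s i) = delta_mx i 0.
  apply/colP => j; rewrite !mxE eqxx andbT nth_uniq ?sE ?standard_words_uniq //.
have e_std w : (size w <= N)%N -> ~ M w -> exists i : 'I_n.+1, w = nth mone s i.
  move=> wN Mw; have ws : w \in s.
    by rewrite mem_standard_words wN; apply/asboolP.
  have iw : (index w s < n.+1)%N by rewrite -sE index_mem.
  by exists (Ordinal iw); rewrite nth_index.
exists n, (fun w => S *m e w); split=> [w Mw|u v uN vN|p pN].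
- by rewrite e0 ?mulmx0.
- rewrite trmx_mul mulmxA -(mulmxA _ S^T) -GS.
  have [Mu|/e_std[//|i ->]] := pselect (M u).
    by rewrite e0 // trmx0 !mul0mx mxE gns_gram_eq0l.
  have [Mv|/e_std[//|j ->]] := pselect (M v).
    by rewrite (e0 v) // mulmx0 mxE gns_gram_eq0r.
  by rewrite !eE trmx_delta -rowE -colE !mxE.
move=> p0 w wp; have [//|/e_std[|i wE]] := pselect (M w); first exact: pN.
have : \sum_(w <- msupp p) p@_w *: e w = 0.
  apply: S_inj; rewrite -[RHS]p0 mulmx_sumr; apply: eq_bigr => u _.
  by rewrite -scalemxAr.
move/(congr1 (fun x : 'cV_n.+1 => x i 0)); rewrite summxE mxE.
rewrite (bigD1_seq w) //= ?fset_uniq // !mxE -wE eqxx mulr1 big1.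
  by rewrite addr0 => /eqP; rewrite mcoeff_eq0 wp.
by move=> u uw; rewrite !mxE -wE eq_sym (negPf uw) mulr0.
Qed.

(** [X i] and its transpose are prescribed as left multiplication by [x_i] and [x_i^*] on the
    vectors of standard words up to length [N], then extended to the whole space. The vectors are
    taken up to length [N.+1] so that these products are represented. *)
Lemma gns_operators N : ~ M mone ->
  exists n (X : 'I_g -> 'M[R]_n.+1) (v : 'cV_n.+1),
  forall p, (forall w, w \in msupp p -> (size w <= N)%N) ->
    (eval X p *m v = 0 <-> forall w, w \in msupp p -> M w).
Proof.
move=> M1; pose s := standard_words N.
(* Two Gram matrices must be positive definite: that of the words up to [N.+1], from which the
   vectors are built, and that of the words up to [N], which makes [V^T *m V] invertible. *)
pose t : R := 1 + 2 * (size s)%:R + 2 * (size (standard_words N.+1))%:R.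
have := ler0n R (size s); have := ler0n R (size (standard_words N.+1)).
move=> h1 h2.
have t1 : 1 <= t by rewrite /t; lra.
have [|n [f [f0 fG f_free]]] := gns_vectors M1 t1 (N := N.+1); first by rewrite /t; lra.
pose k := size s; pose V : 'M[R]_(n.+1, k) := \matrix_(i, j) f (nth mone s j) i 0.
pose A (l : letter g) : 'M[R]_(n.+1, k) :=
  \matrix_(i, j) f (mmul (fmu l) (nth mone s j)) i 0.
have sP i : (i < k)%N -> (size (nth mone s i) <= N)%N /\ ~ M (nth mone s i).
  by move/(mem_nth mone); rewrite mem_standard_words => /andP[? /asboolP].
have gramE (a b : 'I_k -> word g) :
    (forall i, size (a i) <= N.+1)%N -> (forall i, size (b i) <= N.+1)%N ->
    (\matrix_(i, j) f (a j) i 0)^T *m (\matrix_(i, j) f (b j) i 0)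
    = \matrix_(i, j) gns_gram t (a i) (b j).
  move=> aN bN; apply/matrixP => i j; rewrite [RHS]mxE -fG // !mxE.
  by apply: eq_bigr => x _; rewrite !mxE.
have letN l i : (i < k)%N -> (size (mmul (fmu l) (nth mone s i)) <= N.+1)%N.
  by move=> /sP[siN _]; rewrite word_mulE fmuE.
have [X XE] : exists X : 'I_g -> 'M[R]_n.+1, forall i,
    X i *m V = A (i, false) /\ (X i)^T *m V = A (i, true).
  apply: (fin_all_exists (P := fun i Y => Y *m V = A (i, false)
                                       /\ Y^T *m V = A (i, true))) => i.
  apply: adjoint_extension.
    rewrite gramE => [|j|j]; [|by apply/leqW; case: (sP j)..].
    apply/posdef_unit/gns_gram_posdef => //; first by rewrite /t -/s; lra.
      exact: standard_words_uniq.
    by move=> u; rewrite mem_standard_words => /andP[_ /asboolP].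
  rewrite !gramE => [|j|j|j|j]; try exact: letN; try by apply/leqW; case: (sP j).
  apply/matrixP => a b; rewrite !mxE gns_gram_mul; congr (gns_gram _ _ (mmul _ _)).
  by rewrite !fmuE.
have letterE l w : (size w <= N)%N -> letter_eval X l *m f w = f (mmul (fmu l) w).
  move=> wN; have [Mw|Mw] := pselect (M w).
    by rewrite !f0 ?mulmx0 //; exact: M_mull.
  have ws : w \in s by rewrite mem_standard_words wN; apply/asboolP.
  have iw : (index w s < k)%N by rewrite index_mem.
  have colV : f w = col (Ordinal iw) V.
    by apply/colP => i; rewrite !mxE nth_index.
  have XV : letter_eval X l *m V = A l.
    by case: l => i [] /=; case: (XE i).
  rewrite colV colE mulmxA XV -colE; apply/colP => i; rewrite !mxE /= nth_index //.
have wordE w : (size w <= N)%N -> word_eval X w *m f mone = f w.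
  case: w => w; rewrite /word_eval /=.
  elim: w => [|l w IH] wN; first by rewrite big_nil mul1mx word_oneE.
  rewrite big_cons -mulmxE -mulmxA IH; last exact: ltnW.
  rewrite letterE; last exact: ltnW.
  by rewrite word_mulE fmuE.
exists n, X, (f mone) => p pN.
have -> : eval X p *m f mone = \sum_(w <- msupp p) p@_w *: f w.
  rewrite /eval mmapE mulmx_suml big_seq_cond [RHS]big_seq_cond.
  apply: eq_bigr => w /andP[wp _].
  by rewrite -mulmxE mul_scalar_mx -scalemxAl wordE ?pN.
split=> [|pM]; first by apply: f_free => w /pN/leqW.
by rewrite big_seq_cond big1 // => w /andP[/pM/f0 -> _]; rewrite scaler0.
Qed.
End GelfandNaimarkSegal.

(** * Evaluation at matrices and sums of squares *)

Section Evaluation.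
Context (R : realType) (g n : nat) (X : 'I_g -> 'M[R]_n.+1).
Implicit Types (p q : falg R g) (v : 'cV[R]_n.+1).

Lemma word_eval_mmorphism : mmorphism (word_eval X).
Proof.
split=> [u v|]; first by rewrite word_mulE /word_eval big_cat.
by rewrite word_oneE /word_eval big_nil.
Qed.

HB.instance Definition _ :=
  isMultiplicative.Build (word g) 'M[R]_n.+1 (word_eval X) word_eval_mmorphism.

Lemma evalD p q : eval X (p + q) = eval X p + eval X q.
Proof. exact: mmapD. Qed.

Lemma eval_sum r (a : 'I_r -> falg R g) :
  eval X (\sum_(i < r) a i) = \sum_(i < r) eval X (a i).
Proof. exact: raddf_sum. Qed.

Lemma evalM p q : eval X (p * q) = eval X p * eval X q.
Proof.
apply: (commr_mmap_is_multiplicative _).1 => h m m'.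
by rewrite /GRing.comm -!mulmxE scalar_mxC.
Qed.

Lemma word_eval_star w : word_eval X (word_star w) = (word_eval X w)^T.
Proof.
case: w => w; rewrite /word_eval /=; elim: w => [|l w IH].
  by rewrite !big_nil trmx1.
rewrite /= rev_cons -cats1 big_cat big_seq1 IH big_cons -!mulmxE trmx_mul.
by case: l => i []; rewrite /letter_eval /= ?trmxK.
Qed.

Lemma eval_star p : eval X (star p) = (eval X p)^T.
Proof.
rewrite /eval /star raddf_sum [mmap _ _ p]mmapE raddf_sum; apply: eq_bigr => w _.
by rewrite [LHS]mmapU /= word_eval_star -!mulmxE trmx_mul tr_scalar_mx scalar_mxC.
Qed.

(** Pairing the identity with [v] on both sides gives the sum of the squared norms of the [a_i(X) v]
    on the left and 0 on the right. *)
Lemma eval_sos_eq0 v r (a : 'I_r -> falg R g) b d :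
    \sum_(i < r) star (a i) * a i = b + star d ->
    eval X b *m v = 0 -> eval X d *m v = 0 ->
  forall i, eval X (a i) *m v = 0.
Proof.
move=> /(congr1 (eval X)); rewrite eval_sum evalD eval_star => E b0 d0.
pose y i := eval X (a i) *m v.
have sqE : \sum_i ((y i)^T *m y i) 0 0 = 0.
  transitivity ((v^T *m (\sum_i eval X (star (a i) * a i)) *m v) 0 0).
    rewrite mulmx_sumr mulmx_suml summxE; apply: eq_bigr => i _.
    by rewrite evalM eval_star -mulmxE trmx_mul !mulmxA.
  rewrite E mulmxDr mulmxDl -mulmxA b0 -trmx_mul d0 mulmx0 trmx0 mul0mx.
  by rewrite addr0 mxE.
have sq_ge0 (x : 'cV[R]_n.+1) : 0 <= (x^T *m x) 0 0.
  by rewrite mxE sumr_ge0 // => j _; rewrite mxE -expr2 sqr_ge0.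
move=> i; have /eqP := sqE; rewrite psumr_eq0 // => /allP/(_ i).
rewrite mem_index_enum => /(_ isT)/eqP; rewrite mxE => /eqP.
rewrite psumr_eq0 => [/allP y0|j _]; last by rewrite mxE -expr2 sqr_ge0.
apply/colP => j; rewrite [RHS]mxE.
by have := y0 j (mem_index_enum _); rewrite mxE mulf_eq0 orbb => /eqP.
Qed.

(** It lets the vanishing of an ideal at a point be checked on generators. *)
Lemma left_ideal_annihilator v :
  left_ideal [set p : falg R g | eval X p *m v = 0].
Proof.
split=> [|p q /= p0 q0|p q /= q0].
- by rewrite /eval /= mmap0 mul0mx.
- by rewrite evalD mulmxDl p0 q0 addr0.
- by rewrite evalM -mulmxE -mulmxA q0 mulmx0.
Qed.
End Evaluation.

(** * Left monomial ideals and unshrinkable generators *)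

Section MonomialIdeals.
Context (R : realType) (g : nat).
Implicit Types (W : set (word g)) (p : falg R g) (S I : set (falg R g)).

Lemma left_ideal_gen_min S I :
  left_ideal I -> (forall p, S p -> I p) -> forall p, left_ideal_gen S p -> I p.
Proof. by move=> idI SI p; apply; split. Qed.

Lemma left_ideal_gen_ideal S : left_ideal (left_ideal_gen S).
Proof.
split=> [I [[]] //|p q Sp Sq I SI|p q Sq I SI].
  by have [[_ ID _] _] := SI; apply: ID; [apply: Sp|apply: Sq].
by have [[_ _ IM] _] := SI; apply: IM; apply: Sq.
Qed.

Lemma sub_left_ideal_gen S p : S p -> left_ideal_gen S p.
Proof. by move=> Sp I [_]; apply. Qed.

Definition left_multiples W : set (word g) :=
  [set w | exists u w0, W w0 /\ w = mmul u w0].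

Lemma sub_left_multiples W w : W w -> left_multiples W w.
Proof. by move=> Ww; exists mone, w; rewrite mul1m. Qed.

Lemma left_multiples_mull W u w :
  left_multiples W w -> left_multiples W (mmul u w).
Proof. by move=> [u' [w0 [Ww0 ->]]]; exists (mmul u u'), w0; rewrite mulmA. Qed.

(** Polynomials supported on left multiples of [W] form a left ideal, since the support of a product
    lies among products of the supports. Membership thus becomes a condition on words. *)
Lemma mem_left_monomial_ideal W p :
  left_ideal_gen (@monomials R g W) p <->
  forall w, w \in msupp p -> left_multiples W w.
Proof.
split=> [|pW]; last first.
  have [I0 ID IM] := left_ideal_gen_ideal (@monomials R g W).
  rewrite [p]monalgE big_seq; apply: (big_ind _ I0 ID) => w /pW [u [w0 [Ww0 ->]]].
  have -> : << p@_(mmul u w0) *g mmul u w0 >>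
            = << p@_(mmul u w0) *g u >> * << w0 >> :> falg R g.
    by rewrite [RHS]fgmulUU mulr1.
  by apply: IM; apply: sub_left_ideal_gen; exists w0.
pose J := [set p : falg R g | forall w, w \in msupp p -> left_multiples W w].
apply: (@left_ideal_gen_min _ J) => {p} [|p [w Ww <-] u]; last first.
  by rewrite msuppU1 => /fset1P ->; exact: sub_left_multiples.
split=> [w|p q pW qW w|p q qW w]; first by rewrite msupp0.
  by move/(fsubsetP (msuppD_le p q)); rewrite inE => /orP[/pW|/qW].
by move/msuppM_le => [u [v [_ /qW vW ->]]]; apply: left_multiples_mull.
Qed.

Lemma mem_left_monomial_ideal_word W w :
  left_ideal_gen (@monomials R g W) << w >> <-> left_multiples W w.
Proof.
rewrite mem_left_monomial_ideal msuppU1; split=> [|wW u /fset1P -> //].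
by apply; rewrite inE.
Qed.

(** Write [u^* u = t w] with [w] in [W]. If [t] covers [u^*], then [w] is a suffix of [u]. Otherwise
    [u^* = t s] with [s] nonempty, and [w = s u = s s^* t^*] is shrinkable. *)
Lemma left_multiples_real W u :
    (forall w, W w -> left_unshrinkable w) ->
  left_multiples W (mmul (word_star u) u) -> left_multiples W u.
Proof.
move=> Wunshr [t [w [Ww E]]]; move: (E); rewrite !word_mulE => -[Es].
have [tu|ut] := leqP (size u) (size t).
  exists (FMonom (drop (size u) t)), w; split=> //.
  rewrite word_mulE; apply: val_inj => /=.
  have := congr1 (drop (size u)) Es.
  rewrite drop_cat size_word_star ltnn subnn drop0 => Eu.
  rewrite [LHS]Eu drop_cat; case: ltnP => // ut.
  by rewrite (drop_oversize ut) (eqP tu) drop0.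
pose s : word g := FMonom (drop (size t) (word_star u)).
have uE : word_star u = mmul t s.
  rewrite word_mulE; apply: val_inj => /=.
  have := congr1 (take (size t)) Es; rewrite [RHS]take_size_cat // take_cat.
  by rewrite size_word_star ut => tE; rewrite -[X in X ++ _]tE cat_take_drop.
have wE : w = mmul s u.
  have := congr1 (drop (size t)) Es; rewrite [RHS]drop_size_cat // drop_cat.
  by rewrite size_word_star ut word_mulE => E'; apply: val_inj.
case: (Wunshr w Ww); exists s, (word_star t); split.
  move=> s1; have := congr1 (fun w : word g => size w) uE.
  by rewrite s1 mulm1 size_word_star => tu; rewrite tu ltnn in ut.
by rewrite -mulmA -word_starM -uE word_starK.
Qed.

(** Descent on length: a shrinkable [w = u u^* v] is a left multiple of the shorter word [u^* v],
    which remains in the set because [v^* w] is its square. *)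
Lemma left_multiples_unshrinkable W :
    (forall u, left_multiples W (mmul (word_star u) u) -> left_multiples W u) ->
  left_multiples [set w | left_multiples W w /\ left_unshrinkable w]
  = left_multiples W.
Proof.
move=> Wreal; apply/predeqP => w; split=> [[u [w0 [[Ww0 _] ->]]]|].
  exact: left_multiples_mull.
have [m] := ubnP (size w); elim: m w => // m IH w wm Ww.
have [|/contrapT[u [v [u1 wE]]]] := pselect (left_unshrinkable w).
  by move=> wu; exact: sub_left_multiples.
have svE : mmul (word_star v) w = mmul (word_star (mmul (word_star u) v))
                                       (mmul (word_star u) v).
  by rewrite wE word_starM word_starK !mulmA.
have uvW : left_multiples W (mmul (word_star u) v).
  by apply: Wreal; rewrite -svE; exact: left_multiples_mull.
have [|t [w0 [Ww0 E]]] := IH _ _ uvW.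
  rewrite -ltnS; apply: leq_trans wm; rewrite ltnS wE !size_word_mul size_word_star.
  have : size u != 0%N by apply/eqP => /fdeg_eq0I.
  lia.
by exists (mmul u t), w0; rewrite wE -!mulmA E.
Qed.

Lemma unshrinkable_separation W (ps : seq (falg R g)) :
    (forall w, W w -> left_unshrinkable w) ->
  exists n (X : 'I_g -> 'M[R]_n.+1) (v : 'cV_n.+1),
  forall p, p \in ps ->
    (eval X p *m v = 0 <-> left_ideal_gen (@monomials R g W) p).
Proof.
move=> Wunshr; have [W1|W1] := pselect (left_multiples W mone).
  (* Here the ideal is the whole algebra, and the zero vector is annihilated by everything. *)
  exists 0%N, (fun=> 0), 0 => p _; rewrite mulmx0 mem_left_monomial_ideal.
  by split=> // _ w _; rewrite -[w]mulm1; exact: left_multiples_mull.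
pose N := (\max_(p <- ps) \max_(w <- msupp p) size w)%N.
have [n [X [v XvP]]] := gns_operators R (@left_multiples_mull W)
  (fun u => @left_multiples_real W u Wunshr) N W1.
exists n, X, v => p ps_p; rewrite mem_left_monomial_ideal; apply: XvP => w wp.
apply: leq_trans (leq_bigmax_seq _ ps_p isT) => /=.
exact: (@leq_bigmax_seq _ (enum_fset (msupp p)) xpredT (fun w : word g => size w)).
Qed.
End MonomialIdeals.

Theorem theorem1p4 (R : realType) (g : nat) (hg : (0 < g)%N)
    (I : set (falg R g)) (hI : left_monomial_ideal I) :
  (real_left_ideal I <->
     exists W : set (word g),
       (forall w, W w -> left_unshrinkable w) /\
       I = left_ideal_gen (monomials W)) /\
  (fin_gen_left_ideal I ->
     (real_left_ideal I <-> left_nullstellensatz_property I)).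
Proof.
have realP : real_left_ideal I <-> exists W : set (word g),
    (forall w, W w -> left_unshrinkable w) /\ I = left_ideal_gen (@monomials R g W).
  split=> [Ireal|[W [Wunshr IE]] r a].
    have [W IE] := hI.
    (* All unshrinkable words of [I] are taken; reality for a single square [u^* u] provides the
       hypothesis of the descent. *)
    exists [set w | left_multiples W w /\ left_unshrinkable w].
    split=> [w [] //|]; apply/predeqP => p.
    rewrite IE !mem_left_monomial_ideal left_multiples_unshrinkable // => u uuW.
    apply/(mem_left_monomial_ideal_word R); rewrite -IE.
    apply: (Ireal 1%N (fun=> << u >>) _ ord0); rewrite big_ord1.
    have -> : star << u >> = << word_star u >> :> falg R g.
      by rewrite /star msuppU1 big_seq_fset1 mcoeffUU.
    have uuI : I (<< word_star u >> * << u >>).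
      rewrite [_ * _]fgmulUU mulr1 IE; apply/mem_left_monomial_ideal_word.
      exact: uuW.
    exists (<< word_star u >> * << u >>) => //; exists 0; last by rewrite addr0.
    exists 0; last by rewrite /star msupp0 big_seq_fset0.
    by rewrite IE; have [] := left_ideal_gen_ideal (@monomials R g W).
  case=> b Ib [_ [d Id <-] E].
  (* One point must decide membership of [b], [d] and all the [a i] at once: the first two vanish
     there, hence so do the others. *)
  have [n [X [v XvP]]] :=
    unshrinkable_separation (b :: d :: [seq a i | i : 'I_r]) Wunshr.
  move=> i; rewrite IE; apply/XvP.
    by rewrite !inE codom_f !orbT.
  apply: (eval_sos_eq0 (esym E)); apply/XvP; rewrite -?IE // !inE eqxx ?orbT //.
split=> // -[S Sfin IS]; split=> [/realP[W [Wunshr IE]]|Inull r a].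
  apply/predeqP => p; split=> [|Ip n Xv XvI]; last exact: XvI.
  have [ps psE] := (finite_seqP _).1 Sfin.
  (* With the finitely many generators in the list, the point lies in the zero locus of [I], so an
     element [p] of the radical vanishes there. *)
  have [n [X [v XvP]]] := unshrinkable_separation (p :: ps) Wunshr.
  move=> /(_ n (X, v)) radp; rewrite IE; apply/XvP; first exact: mem_head.
  apply: radp => q; rewrite /= IS.
  apply: (left_ideal_gen_min (left_ideal_annihilator X v)) => {}q Sq /=.
  apply/XvP; last by rewrite -IE IS; exact: sub_left_ideal_gen.
  by move: Sq; rewrite psE /= inE => ->; rewrite orbT.
(* At every point of the zero locus [b] and [d] vanish, hence each [a i] does, which puts it in the
   radical. *)
case=> b Ib [_ [d Id <-] E] i; rewrite -Inull => n [X v] XvI.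
by apply: (eval_sos_eq0 (esym E)); [apply: (XvI b)|apply: (XvI d)].
Qed.
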